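(* Let $f,g,F=f+g$ and $\{D^k\},\{\epsilon^k\}$ be as in the context, with $\epsilon^k\le\overline\epsilon<\frac mL$ for all $k$. Let $\{x^k\}$ be generated by the VBPG method and suppose $\{x^k\}$ converges to $\overline x\in\overline{\mathbf X}_L$; put $\overline F=F(\overline x)$. Assume that the level-set subdifferential error bound holds at $\overline x$ with exponent $\gamma\in(0,1]$, $\eta>0$ and $\nu>0$ (i.e. over $\mathfrak{B}(\overline x;\eta,\nu)$). Let $N>\frac{2\overline\epsilon\nu}{m-\overline\epsilon L}\big/\left(\frac\eta2\right)^2$, let $a=\frac12\left(\frac m{\overline\epsilon}-L\right)$ and let $\kappa'=c_0\theta^2$ be the constant described in the context. Let $\sigma\in(0,\frac\eta2)$ and $\bar\nu\in\left(0,\min\{\frac\nu N,a(\frac\eta2-\sigma)^2\}\right)$. Suppose there is $k_0$ such that $$\overline F<F(x^{k_0})<\overline F+\bar\nu\quad\text{and}\quad\|x^{k_0}-\overline x\|+\frac{2(\sqrt a+\sqrt{\kappa'})}{a}\sqrt{F(x^{k_0})-\overline F}<\sigma.$$ Then $\{F(x^k)\}$ converges to $\overline F$ at a $Q$-linear rate; that is, there are $\beta\in(0,1)$ and $k_0$ such that $$F(x^{k+1})-\overline F\le\beta\,(F(x^k)-\overline F),\qquad\forall k\ge k_0.$$ As a consequence, $\sum_{i=1}^\infty\left(F(x^i)-\overline F\right)<+\infty$. Moreover, $\{x^k\}$ converges at an $R$-linear rate to a critical point $\hat x$ of $F$: a limiting critical point, or a proximal critical point if $D^k=D$ for all $k$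 and $\epsilon^k\to\hat\epsilon\in\left(\underline\epsilon,\frac mL\right)$.
   Context: Assumptions on $f,g$: $f:\mathbb{R}^n\to(-\infty,\infty]$ is a proper lower semicontinuous (possibly nonconvex) function, differentiable on $\mathrm{dom} f$, with $\mathrm{dom} f$ convex and $\nabla f$ $L$-Lipschitz continuous on $\mathrm{dom} f$; $g:\mathbb{R}^n\to(-\infty,\infty]$ is proper, lower semicontinuous (possibly nonconvex and nonsmooth), continuous on $\mathrm{dom} g$, and $\mathrm{dom} g$ is convex; $F=f+g$ is level-bounded, i.e. $\{x: F(x)\le r\}$ is bounded (possibly empty) for every $r\in\mathbb{R}$. Variable Bregman distances: for each $k$, $K^k:\mathbb{R}^n\to\mathbb{R}$ is strongly convex with modulus $m^k\ge m>0$ and $\nabla K^k$ is $M^k$-Lipschitz with $M^k\le M$; $D^k(x,y)=K^k(y)-[K^k(x)+\langle\nabla K^k(x),y-x\rangle]$; and $0<\underline\epsilon\le\epsilon^k\le\overline\epsilon$. Set $T_{D^k,\epsilon^k}(x)=\arg\min_{y\in\mathbb{R}^n}\{\langle\nabla f(x),y-x\rangle+g(y)+\frac1{\epsilon^k}D^k(x,y)\}$. VBPG method: from $x^0\in\mathbb{R}^n$, for $k=0,1,\dots$ choose $x^{k+1}\in T_{D^k,\epsilon^k}(x^k)$. Subdifferentials: $\partial_P\psi(\bar x)=\{\xi:\exists\rho>0,r>0\text{ s.t. }\psi(x)\ge\psi(\bar x)+\langle\xi,x-\bar x\rangle-\rho\|x-\bar x\|^2\ \forall x\in\mathbb{B}(\bar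 x;r)\}$ (proximal), $\mathbb{B}$ the open ball; $\partial_L\psi$ denotes the limiting (Mordukhovich) subdifferential. $\overline{\mathbf X}_L=\{x:0\in\nabla f(x)+\partial_Lg(x)\}$ is the set of limiting critical points; a proximal critical point is $x$ with $0\in\partial_PF(x)$. $[F\le\overline F]=\{x:F(x)\le\overline F\}$; $\mathrm{dist}(x,C)=\inf_{z\in C}\|x-z\|$ ($=\infty$ if $C=\emptyset$); $\mathfrak{B}(\overline x;\eta,\nu)=\mathbb{B}(\overline x;\eta)\cap\{x:\overline F<F(x)<\overline F+\nu\}$. The level-set subdifferential error bound holds at $\overline x$ with exponent $\gamma$ over $\mathfrak{B}(\overline x;\eta,\nu)$ if there is $c_3>0$ with $\mathrm{dist}^\gamma(x,[F\le\overline F])\le c_3\,\mathrm{dist}(0,\partial_PF(x))$ for all $x\in\mathfrak{B}(\overline x;\eta,\nu)$. Constant $\kappa'$: $c_0=\frac32L+\frac M{2\underline\epsilon}$, and $\theta>0$ is a constant independent of $k$ such that $\mathrm{dist}(x,[F\le\overline F])\le\theta\,\mathrm{dist}(x,T_{D^k,\epsilon^k}(x))$ for all $x\in\mathfrak{B}(\overline x;\frac\eta2,\frac\nu N)$ and all $k$ (the existence of such $\theta$ under the level-set subdifferential error bound with $\gamma\in(0,1]$ is established in the paper); $\kappa'=c_0\theta^2$. $R$-linear convergence of $\{x^k\}$ to $\hat x$ means $\limsup_{k\to\infty}\|x^k-\hat x\|^{1/k}<1$. *)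

(* Defs.v *)
From HB Require Import structures.
From mathcomp Require Import all_boot all_order all_algebra.
From mathcomp Require Import all_classical all_reals all_analysis.

Set Implicit Arguments.
Unset Strict Implicit.
Unset Printing Implicit Defensive.

Import Order.TTheory GRing.Theory Num.Theory.
Import numFieldNormedType.Exports.

Local Open Scope classical_set_scope.
Local Open Scope ring_scope.

Section Euclidean.
Context {R : realType} {n : nat}.
Implicit Types (x y u v : 'rV[R]_n) (C : set 'rV[R]_n).

Definition dot u v : R := \sum_(i < n) u 0 i * v 0 i.

(* The library norm on 'rV[R]_n is the sup norm: it induces the same topology,
   filters and bounded sets as the Euclidean norm, but not the same constants. *)
Definition enorm u : R := Num.sqrt (dot u u).

Definition eball x (r : R) : set 'rV[R]_n := [set y | enorm (y - x) < r].

Definition edist_to x C : \bar R := ereal_inf [set (enorm (x - z))%:E | z in C].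

Definition lipschitz_with (L : R) C (G : 'rV[R]_n -> 'rV[R]_n) : Prop :=
  forall x y, C x -> C y -> enorm (G x - G y) <= L * enorm (x - y).

Definition gradient (K : 'rV[R]_n -> R) x : 'rV[R]_n :=
  \row_(i < n) 'd K x (delta_mx 0 i).

Definition strongly_convex (m : R) (K : 'rV[R]_n -> R) : Prop :=
  forall x y (t : R), 0 <= t <= 1 ->
    K (t *: x + (1 - t) *: y) <=
      t * K x + (1 - t) * K y - m / 2 * t * (1 - t) * enorm (x - y) ^+ 2.

Definition bregman (K : 'rV[R]_n -> R) x y : R :=
  K y - (K x + dot (gradient K x) (y - x)).

Definition R_linear_cvg (x : nat -> 'rV[R]_n) (xh : 'rV[R]_n) : Prop :=
  x @ \oo --> xh /\
  (limn_esup (fun k => (enorm (x k - xh) `^ (k%:R^-1))%:E) < 1)%E.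

End Euclidean.

Section ExtendedRealValued.
Context {R : realType} {n : nat}.
Implicit Types (x y xi : 'rV[R]_n) (psi f g F : 'rV[R]_n -> \bar R).

Definition edom psi : set 'rV[R]_n := [set x | (psi x < +oo)%E].

Definition eproper psi : Prop :=
  (forall x, (-oo < psi x)%E) /\ edom psi !=set0.

Definition convex_edom psi : Prop :=
  convex_set (edom psi : set (convex_lmodType 'rV[R]_n)).

(* [v] is a gradient of [f] at [x], relative to the domain of [f]. This is the
   usual gradient at interior points of the domain; at the other points of the
   domain, [f] is +oo arbitrarily close to [x], so that the expansion can only
   be required along the domain. *)
Definition is_gradient_on_dom f x (v : 'rV[R]_n) : Prop :=
  forall e : R, 0 < e -> \forall y \near within (edom f) (nbhs x),
    `|fine (f y) - fine (f x) - dot v (y - x)| <= e * enorm (y - x).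

Definition level_bounded F : Prop :=
  forall r : R, bounded_set [set x | (F x <= r%:E)%E].

Definition sublevel F (c : \bar R) : set 'rV[R]_n := [set x | (F x <= c)%E].

(* By convention subdifferentials are empty outside of the domain of [psi]. *)
Definition prox_subdiff psi x : set 'rV[R]_n :=
  [set xi | edom psi x /\
    exists rho r : R, [/\ 0 < rho, 0 < r & forall y, eball x r y ->
      (psi x + (dot xi (y - x) - rho * enorm (y - x) ^+ 2)%:E <= psi y)%E]].

Definition frechet_subdiff psi x : set 'rV[R]_n :=
  [set xi | edom psi x /\
    forall e : R, 0 < e -> exists2 r : R, 0 < r & forall y, eball x r y ->
      (psi x + (dot xi (y - x) - e * enorm (y - x))%:E <= psi y)%E].

Definition lim_subdiff psi x : set 'rV[R]_n :=
  [set xi | edom psi x /\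
    exists (u : nat -> 'rV[R]_n) (zeta : nat -> 'rV[R]_n),
      [/\ u @ \oo --> x, psi (u k) @[k --> \oo] --> psi x,
          forall k, frechet_subdiff psi (u k) (zeta k) &
          zeta @ \oo --> xi]].

Definition limiting_critical f (df : 'rV[R]_n -> 'rV[R]_n) g x : Prop :=
  edom f x /\ exists2 xi, lim_subdiff g x xi & df x + xi = 0.

Definition proximal_critical F x : Prop := prox_subdiff F x 0.

(* \mathfrak{B}(xb; eta, nu) *)
Definition ball_slice F (xb : 'rV[R]_n) (eta nu : R) : set 'rV[R]_n :=
  eball xb eta `&` [set x | (F xb < F x < F xb + nu%:E)%E].

Definition level_set_error_bound F (xb : 'rV[R]_n) (gamma eta nu : R) : Prop :=
  exists2 c3 : R, 0 < c3 & forall x, ball_slice F xb eta nu x ->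
    (edist_to x (sublevel F (F xb)) `^ gamma
       <= c3%:E * edist_to 0 (prox_subdiff F x))%E.

Definition prox_objective (df : 'rV[R]_n -> 'rV[R]_n) g
    (K : 'rV[R]_n -> R) (eps : R) x y : \bar R :=
  ((dot (df x) (y - x))%:E + g y + (eps^-1 * bregman K x y)%:E)%E.

(* The set T_{D,eps}(x); it involves the gradient of f at x, hence is only
   defined (here: nonempty) for x in the domain of f. *)
Definition prox_map f (df : 'rV[R]_n -> 'rV[R]_n) g
    (K : 'rV[R]_n -> R) (eps : R) x : set 'rV[R]_n :=
  [set p | edom f x /\
    forall y, (prox_objective df g K eps x p <= prox_objective df g K eps x y)%E].

Definition vbpg f (df : 'rV[R]_n -> 'rV[R]_n) g
    (K : nat -> 'rV[R]_n -> R) (eps : nat -> R) (x : nat -> 'rV[R]_n) : Prop :=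
  forall k, prox_map f df g (K k) (eps k) (x k) (x k.+1).

Definition Q_linear_cvg (u : nat -> \bar R) (l : \bar R) : Prop :=
  u @ \oo --> l /\
  exists2 beta : R, 0 < beta < 1 & exists k1 : nat, forall k, (k1 <= k)%N ->
    (u k.+1 - l <= beta%:E * (u k - l))%E.

End ExtendedRealValued.

(* Main.v *)
Require Import Defs.
From mathcomp Require Import all_boot all_order all_algebra.
From mathcomp Require Import all_classical all_reals all_analysis.
From mathcomp Require Import ring lra.
Import Order.TTheory GRing.Theory Num.Theory.
Import numFieldNormedType.Exports.
Local Open Scope classical_set_scope.
Local Open Scope ring_scope.

(** Write [s_k = |x_{k+1} - x_k|]. Everything follows from one inequality
    ([prox_step]): since [x_{k+1}] minimises the proximal objective at [x_k],
    the quadratic bounds on [f] and on the Bregman distance give, for every [u],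
      [F(x_{k+1}) + a s_k^2 <= F(u) + c0 |u - x_k|^2].

    - With [u = x_k], this is sufficient decrease:
      [F(x_{k+1}) + a s_k^2 <= F(x_k)]. As [F] is lower semicontinuous, the
      values [F(x_k)] then decrease and stay above [F(xb)].
    - Once [k >= k0] and [x_k] is within [eta / 2] of [xb], either
      [F(x_k) = F(xb)] or [x_k] lies in the slice, and then points [u] of
      [[F <= F(xb)]] are found at distance almost [theta s_k] of [x_k]. The
      inequality at these [u] gives [F(x_{k+1}) - F(xb) <= kappa s_k^2]
      ([edist_to_growth]).
    - Eliminating [s_k^2] between the two yields the Q-linear rate with ratio
      [kappa / (a + kappa)]. Summability is that of a geometric sequence
      ([ratio_summable]), and sufficient decrease turns the rate of the values
      into a geometric bound on [s_k], hence into the R-linear rate of the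
      iterates ([geometric_steps_R_linear]).
    - The limit of the iterates is [xb], a limiting critical point. Letting
      [k] tend to infinity in the inequality with [u] fixed gives
      [F(xb) <= F(u) + c0 |u - xb|^2] for all [u], so that [xb] is also a
      proximal critical point. *)

(** * Euclidean norm *)
Section EuclideanNorm.
Context {R : realType} {n : nat}.
Implicit Types (u v w : 'rV[R]_n) (t : R).

Lemma dotC u v : dot u v = dot v u.
Proof. by apply: eq_bigr => i _; rewrite mulrC. Qed.

Lemma dotDr u v w : dot u (v + w) = dot u v + dot u w.
Proof. by rewrite -big_split; apply: eq_bigr => i _; rewrite mxE mulrDr. Qed.

Lemma dotZr t u v : dot u (t *: v) = t * dot u v.
Proof. by rewrite mulr_sumr; apply: eq_bigr => i _; rewrite mxE mulrCA. Qed.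

Lemma dotNr u v : dot u (- v) = - dot u v.
Proof. by rewrite -scaleN1r dotZr mulN1r. Qed.

Lemma dotBl u v w : dot (u - v) w = dot u w - dot v w.
Proof. by rewrite dotC dotDr dotNr !(dotC w). Qed.

Lemma dot_self_ge0 u : 0 <= dot u u.
Proof. by apply: sumr_ge0 => i _; rewrite -expr2 sqr_ge0. Qed.

Lemma enorm_ge0 u : 0 <= enorm u.
Proof. exact: sqrtr_ge0. Qed.

Lemma sqr_enorm u : enorm u ^+ 2 = dot u u.
Proof. by rewrite sqr_sqrtr // dot_self_ge0. Qed.

Lemma enormZ t u : enorm (t *: u) = `|t| * enorm u.
Proof.
rewrite /enorm dotZr dotC dotZr mulrA -expr2 sqrtrM ?sqr_ge0//.
by rewrite sqrtr_sqr.
Qed.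

Lemma enormN u : enorm (- u) = enorm u.
Proof. by rewrite -scaleN1r enormZ normrN1 mul1r. Qed.

Lemma enorm_distC u v : enorm (u - v) = enorm (v - u).
Proof. by rewrite -enormN opprB. Qed.

(** The square norm of [|v| u - |u| v] is [2 |u| |v| (|u| |v| - <u, v>)], which
    settles the case of nonzero vectors. *)
Lemma cauchy_schwarz u v : dot u v <= enorm u * enorm v.
Proof.
have [u0|u0] := eqVneq (enorm u) 0.
  suff -> : dot u v = 0 by rewrite u0 mul0r.
  have uu0 : dot u u = 0 by rewrite -sqr_enorm u0 expr0n.
  rewrite /dot big1// => i _.
  have /eqP : u 0 i * u 0 i = 0.
    apply: (psumr_eq0P _ uu0) => // j _; by rewrite -expr2 sqr_ge0.
  by rewrite mulf_eq0 orbb => /eqP ->; rewrite mul0r.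
have [v0|v0] := eqVneq (enorm v) 0.
  suff -> : dot u v = 0 by rewrite v0 mulr0.
  have vv0 : dot v v = 0 by rewrite -sqr_enorm v0 expr0n.
  rewrite /dot big1// => i _.
  have /eqP : v 0 i * v 0 i = 0.
    apply: (psumr_eq0P _ vv0) => // j _; by rewrite -expr2 sqr_ge0.
  by rewrite mulf_eq0 orbb => /eqP ->; rewrite mulr0.
have ugt : 0 < enorm u by rewrite lt_neqAle eq_sym u0 enorm_ge0.
have vgt : 0 < enorm v by rewrite lt_neqAle eq_sym v0 enorm_ge0.
have := dot_self_ge0 (enorm v *: u - enorm u *: v).
rewrite dotDr dotNr !dotZr !dotBl !(dotC (_ *: _)) !dotZr -!sqr_enorm.
rewrite (dotC v u).
have -> : enorm v * (enorm v * enorm u ^+ 2 - enorm u * dot u v) -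
  enorm u * (enorm v * dot u v - enorm u * enorm v ^+ 2) =
  (enorm u * enorm v) * (2 * (enorm u * enorm v - dot u v)) by ring.
rewrite pmulr_rge0 ?mulr_gt0// pmulr_rge0// ?subr_ge0//.
Qed.

Lemma enorm_triangle u v : enorm (u + v) <= enorm u + enorm v.
Proof.
rewrite -(@ler_pXn2r _ 2) ?nnegrE ?addr_ge0 ?enorm_ge0//.
rewrite sqr_enorm dotDr dotC dotDr (dotC (u + v)) dotDr (dotC v u).
rewrite sqrrD !sqr_enorm; have := cauchy_schwarz u v; lra.
Qed.

(** Together with [sup_le_enorm], this makes the Euclidean norm equivalent to the
    sup norm, from which the topology of row vectors is defined. *)
Lemma enorm_le_sup u : enorm u <= Num.sqrt n%:R * `|u|.
Proof.
rewrite -(@ger0_norm _ `|u|)// -sqrtr_sqr -sqrtrM ?ler0n//.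
apply: ler_wsqrtr; apply: (@le_trans _ _ (\sum_(i < n) `|u| ^+ 2)); last first.
  by rewrite sumr_const card_ord mulr_natl.
apply: ler_sum => i _; rewrite -expr2 -real_normK ?num_real//.
apply: lerXn2r; rewrite ?nnegrE//.
rewrite [leRHS]mx_normrE; exact: (le_bigmax _ (fun ij => `|u ij.1 ij.2|) (0, i)).
Qed.

Lemma sup_le_enorm u : `|u| <= enorm u.
Proof.
rewrite [leLHS]mx_normrE; apply: bigmax_le; first exact: enorm_ge0.
move=> [i j] _ /=; rewrite (ord1 i) -sqrtr_sqr; apply: ler_wsqrtr.
rewrite /dot (bigD1 j)//= -expr2 lerDl; apply: sumr_ge0 => k _.
by rewrite -expr2 sqr_ge0.
Qed.

Lemma cvg_enorm_dist (x : nat -> 'rV[R]_n) (xb : 'rV[R]_n) :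
  x @ \oo --> xb -> enorm (x k - xb) @[k --> \oo] --> (0 : R).
Proof.
move=> xxb.
apply: (@squeeze_cvgr _ _ _ _ (cst 0) (fun k => Num.sqrt n%:R * `|x k - xb|)).
- by apply: nearW => k; rewrite enorm_ge0 enorm_le_sup.
- exact: cvg_cst.
- rewrite -[X in _ --> X](mulr0 (Num.sqrt n%:R)); apply: cvgMr.
  rewrite -(normr0 'rV[R]_n) -(subrr xb); apply: cvg_norm.
  by apply: cvgB => //; exact: cvg_cst.
Qed.
End EuclideanNorm.

(** * First-order expansions and the descent lemma *)
Section FirstOrder.
Context {R : realType}.

(** The mean value theorem, with the derivative given by a first-order expansion
    relative to the interval: this form also makes sense at the end points, where
    it yields the continuity that the mean value theorem needs. *)
Lemma expansion_nonincreasing (f c : R -> R) :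
  (forall t : R, 0 <= t <= 1 -> forall e : R, 0 < e ->
    \forall s \near t, 0 <= s <= 1 -> `|f s - f t - c t * (s - t)| <= e * `|s - t|) ->
  (forall t, 0 <= t <= 1 -> c t <= 0) -> f 1 <= f 0.
Proof.
move=> fc c0; have [| |] := @MVT R f c 0 1 ltr01.
- move=> t /[!in_itv]/= /andP[t0 t1].
  have D : (fun h => h^-1 *: (f (h *: 1 + t) - f t)) @ 0^' --> c t.
    apply/cvgrPdist_le => e e0.
    have t01 : 0 <= t <= 1 by rewrite !ltW.
    have /nbhs_ballP[r /= r0 br] := fc t t01 e e0.
    near=> h.
    have h0 : h != 0 by near: h; exact: nbhs_dnbhs_neq.
    have hr : `|h| < r.
      near: h; apply: dnbhs0_lt; exact: r0.
    have ht : `|h| < t by near: h; apply: dnbhs0_lt.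
    have h1t : `|h| < 1 - t by near: h; apply: dnbhs0_lt; rewrite subr_gt0.
    have bh : ball t r (h *: 1 + t).
      rewrite /ball/= /ball_ [h *: 1]mulr1 opprD addrCA subrr addr0 normrN//.
    have := br _ bh.
    rewrite [h *: 1]mulr1 => /(_ _) H.
    have {}H : `|f (h + t) - f t - c t * h| <= e * `|h|.
      have := H; rewrite addrK; apply.
      move: ht h1t; rewrite !ltr_norml => /andP[? ?] /andP[? ?].
      by apply/andP; split; lra.
    have -> : c t - h^-1 *: (f (h + t) - f t) =
      - (h^-1 * (f (h + t) - f t - c t * h)).
      by rewrite /GRing.scale/=; field.
    rewrite normrN normrM normfV ler_pdivrMl ?normr_gt0// [leRHS]mulrC; exact: H.
  apply: DeriveDef; first by apply/cvg_ex; exists (c t).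
  exact/cvg_lim.
- have I (s : R) : `[0, 1]%classic s -> 0 <= s <= 1 by rewrite /= in_itv.
  apply/subspace_continuousP => t /I t01.
  apply/cvgrPdist_le => e e0.
  have := fc t t01 1 ltr01; rewrite near_withinE => H.
  near=> s => /I s01.
  have H' : `|f s - f t - c t * (s - t)| <= 1 * `|s - t|.
    by move: s01; near: s; exact: H.
  have K0 : 0 < 1 + `|c t| by rewrite ltr_pwDl.
  rewrite distrC; apply: (@le_trans _ _ ((1 + `|c t|) * `|s - t|)).
    rewrite -[f s - f t](subrK (c t * (s - t))).
    by apply: (le_trans (ler_normD _ _)); rewrite mulrDl lerD// normrM.
  rewrite mulrC -ler_pdivlMr// distrC.
  near: s; apply: cvgr_dist_le => //; exact: divr_gt0.
- move=> t; rewrite in_itv/= => /andP[t0 t1].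
  rewrite subr0 mulr1 => E.
  have t01 : 0 <= t <= 1 by rewrite !ltW.
  have := c0 t t01; lra.
Unshelve. all: by end_near. Qed.

Context {n : nat}.
Implicit Types (x y z : 'rV[R]_n) (C : set 'rV[R]_n).

Definition segment_closed C := forall x y (t : R),
  C x -> C y -> 0 <= t <= 1 -> C (x + t *: (y - x)).

(** The real-valued form of [is_gradient_on_dom], so that the same results apply
    to [f] on its domain and to the kernels [K k] on the whole space. *)
Definition expansion_on C (h : 'rV[R]_n -> R) (dh : 'rV[R]_n -> 'rV[R]_n) :=
  forall z, C z -> forall e : R, 0 < e -> \forall y \near within C (nbhs z),
    `|h y - h z - dot (dh z) (y - z)| <= e * enorm (y - z).

(** The descent lemma. Along [t |-> x + t (y - x)], the derivative of
    [h - t <dh x, y - x> - L / 2 |y - x|^2 t^2] is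
    [<dh (x + t (y - x)) - dh x, y - x> - L t |y - x|^2], which is nonpositive by
    the Lipschitz bound and Cauchy-Schwarz. *)
Lemma quadratic_upper_bound C h dh (L : R) x y :
  segment_closed C -> expansion_on C h dh -> lipschitz_with L C dh ->
  C x -> C y -> h y - h x - dot (dh x) (y - x) <= L / 2 * enorm (y - x) ^+ 2.
Proof.
move=> segC expC lipC Cx Cy; set d := y - x; pose z t := x + t *: d.
have zd s t : z s - z t = (s - t) *: d.
  by rewrite /z opprD addrACA subrr add0r -scalerBl.
have Cz t : 0 <= t <= 1 -> C (z t) by move=> t01; exact: segC.
have z0 : z 0 = x by rewrite /z scale0r addr0.
have z1 : z 1 = y by rewrite /z scale1r addrCA subrr addr0.
pose f t := h (z t) - t * dot (dh x) d - L / 2 * enorm d ^+ 2 * t ^+ 2.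
pose c t := dot (dh (z t) - dh x) d - L * t * enorm d ^+ 2.
have zcont t : z s @[s --> t] --> z t.
  by apply: cvgD; [exact: cvg_cst | apply: cvgZl; exact: cvg_id].
suff : f 1 <= f 0 by rewrite /f z0 z1 expr1n expr0n /=; lra.
apply: (@expansion_nonincreasing f c) => [t t01 e e0|t t01].
  (* One half of [e] bounds the remainder of [h], the other half the quadratic
     term; adding 1 to the denominators covers the case [d = 0]. *)
  have e1 : 0 < e / 2 / (enorm d + 1).
    by rewrite !divr_gt0// ltr_wpDl// enorm_ge0.
  have := expC (z t) (Cz t t01) _ e1; rewrite near_withinE => H.
  have := zcont t _ H; rewrite near_simpl => {}H.
  have L1 : 0 < `|L| * enorm d ^+ 2 + 1 by rewrite ltr_wpDl// mulr_ge0// sqr_ge0.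
  have e2 : 0 < e / (`|L| * enorm d ^+ 2 + 1) by rewrite divr_gt0.
  near=> s => s01.
  have Hs : `|h (z s) - h (z t) - dot (dh (z t)) (z s - z t)| <=
     e / 2 / (enorm d + 1) * enorm (z s - z t).
    by move: (Cz s s01); near: s; exact: H.
  have st : `|s - t| <= e / (`|L| * enorm d ^+ 2 + 1).
    by rewrite distrC; near: s; apply: cvgr_dist_le.
  have -> : f s - f t - c t * (s - t) =
    (h (z s) - h (z t) - dot (dh (z t)) (z s - z t))
    - L / 2 * enorm d ^+ 2 * (s - t) ^+ 2.
    by rewrite zd dotZr /f /c dotBl; field.
  apply: (le_trans (ler_normB _ _)).
  have -> : e * `|s - t| = e / 2 * `|s - t| + e / 2 * `|s - t| by field.
  apply: lerD.
    apply: (le_trans Hs); rewrite zd enormZ.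
    have -> : e / 2 / (enorm d + 1) * (`|s - t| * enorm d) =
      e / 2 * `|s - t| * (enorm d / (enorm d + 1)) by ring.
    have d0 := enorm_ge0 d; rewrite ler_piMr ?mulr_ge0 ?divr_ge0 ?(ltW e0)//.
    by rewrite ler_pdivrMr ?mul1r ?lerDl// ltr_wpDl.
  rewrite 2!normrM (normrM L) (ger0_norm (sqr_ge0 (enorm d))) normrX.
  rewrite (@ger0_norm _ 2^-1)// expr2 mulrA ler_wpM2r//.
  move: st; rewrite ler_pdivlMr// => st.
  have := normr_ge0 (s - t); lra.
have /andP[t0 _] := t01.
have /= := lipC (z t) x (Cz t t01) Cx.
rewrite -z0 zd subr0 z0 enormZ (ger0_norm t0) => lip.
rewrite /c subr_le0; apply: (le_trans (cauchy_schwarz _ _)).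
by rewrite expr2 mulrA ler_wpM2r ?enorm_ge0// -mulrA.
Unshelve. all: by end_near. Qed.

(** The lower bound is the upper bound for [- h]. *)
Lemma quadratic_bound C h dh (L : R) x y :
  segment_closed C -> expansion_on C h dh -> lipschitz_with L C dh ->
  C x -> C y -> `|h y - h x - dot (dh x) (y - x)| <= L / 2 * enorm (y - x) ^+ 2.
Proof.
move=> segC expC lipC Cx Cy; rewrite ler_norml; apply/andP; split; last first.
  exact: (@quadratic_upper_bound C).
have dN u v : dot (- u) v = - dot u v :> R.
  by move=> *; rewrite dotC dotNr dotC.
have := @quadratic_upper_bound C (fun z => - h z) (fun z => - dh z) L x y segC.
rewrite dN => H; rewrite lerNl; apply: le_trans (H _ _ Cx Cy); first by lra.
  move=> z Cz e e0; have := expC z Cz e e0; apply: filterS => w.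
  by rewrite dN -normrN; congr (`|_| <= _); ring.
by move=> u v Cu Cv; rewrite -opprD enormN; exact: lipC.
Qed.

Lemma dot_gradient (K : 'rV[R]_n -> R) z v : dot (gradient K z) v = 'd K z v.
Proof.
rewrite [in RHS](row_sum_delta v) linear_sum; apply: eq_bigr => i _.
by rewrite mxE linearZ/= mulrC.
Qed.

Lemma differentiable_expansion (K : 'rV[R]_n -> R) :
  (forall z, differentiable K z) -> expansion_on setT K (gradient K).
Proof.
move=> dK z _ e e0; rewrite near_withinE.
have /eqaddoP/(_ e e0) H := diff_locally (dK z).
have {}H : \forall v \near (0 : 'rV[R]_n),
    `|(K \o shift z - (cst (K z) + 'd K z)) v| <= e * `|v| by exact: H.
move: H; rewrite (near_shift z) => H; near=> y => _.
have : `|(K \o shift z - (cst (K z) + 'd K z)) (y - z)| <= e * `|y - z|.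
  by near: y; apply: filterS H => y /=; rewrite sub0r.
rewrite dot_gradient.
have -> : (K \o shift z - (cst (K z) + 'd K z)) (y - z) = K y - K z - 'd K z (y - z).
  by rewrite !fctE /= subrK opprD addrA.
by move=> /le_trans; apply; rewrite ler_pM2l// sup_le_enorm.
Unshelve. all: by end_near. Qed.
End FirstOrder.

(** * Sequences with geometric decay *)
Section GeometricSequences.
Context {R : realType}.

Lemma geometric_decay (phi : nat -> R) (b : R) k1 : 0 <= b ->
  (forall k, (k1 <= k)%N -> phi k.+1 <= b * phi k) ->
  forall k, (k1 <= k)%N -> phi k <= b ^+ (k - k1) * phi k1.
Proof.
move=> b0 ratio k /subnK <-; rewrite addnK; elim: (k - k1)%N => [|j IH].
  by rewrite mul1r.
rewrite addSn; apply: (le_trans (ratio _ (leq_addl _ _))).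
by rewrite exprS -mulrA ler_wpM2l.
Qed.

(** The partial sums plus [phi j / (1 - b)], the geometric bound on the remaining
    sum, are nonincreasing from [k1] on. *)
Lemma ratio_summable (phi : nat -> R) (b : R) m k1 : b < 1 ->
  (forall k, (m <= k)%N -> 0 <= phi k) ->
  (forall k, (k1 <= k)%N -> phi k.+1 <= b * phi k) ->
  exists S : R, (\sum_(m <= i < j) phi i) @[j --> \oo] --> S.
Proof.
move=> b1 phi0 ratio; pose P j := \sum_(m <= i < j) phi i.
have P_nd : nondecreasing_seq P.
  apply/nondecreasing_seqP => j; rewrite /P.
  have [mj|jm] := leqP m j; first by rewrite big_nat_recr//= lerDl phi0.
  by rewrite !big_geq// ltnW.
suff ubP : has_ubound (range P).
  by exists (limn P); exact: nondecreasing_is_cvgn.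
pose k2 := maxn m k1.
pose w := (1 - b)^-1.
have w0 : 0 < w by rewrite invr_gt0 subr_gt0.
have wE : w = 1 + b * w.
  have : (1 - b) * w = 1 by rewrite divff// gt_eqF// subr_gt0.
  by move=> h; rewrite -[X in X + _]h; ring.
have PS j : (k2 <= j)%N -> P j + phi j * w <= P k2 + phi k2 * w.
  move=> /subnK <-; elim: (j - k2)%N => // i; apply: le_trans.
  have [mi ki] : (m <= i + k2 /\ k1 <= i + k2)%N.
    by split; rewrite (leq_trans _ (leq_addl _ _))// /k2 ?leq_maxl ?leq_maxr.
  rewrite addSn {1}/P big_nat_recr//= -/(P _) -addrA lerD2l.
  rewrite {2}wE mulrDr mulr1 lerD2l mulrA (mulrC _ b).
  by rewrite ler_wpM2r ?(ltW w0)// ratio.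
exists (P k2 + phi k2 * w) => _ [j _ <-].
have [kj|/ltnW jk] := leqP k2 j.
  apply: le_trans (PS j kj); rewrite lerDl mulr_ge0 ?(ltW w0)//.
  by apply: phi0; apply: leq_trans kj; exact: leq_maxl.
apply: (le_trans (P_nd _ _ jk)); rewrite lerDl mulr_ge0 ?(ltW w0)//.
by apply: phi0; exact: leq_maxl.
Qed.

(** Summing the steps bounds the distance to the limit by
    [C / (1 - q) * q ^+ k]; for any [r] strictly between [q] and [1] this is
    eventually below [r ^+ k], whatever the constant, so the limsup of the roots
    is at most [r]. *)
Lemma geometric_steps_R_linear {n : nat} (x : nat -> 'rV[R]_n) (xb : 'rV[R]_n)
    (q C : R) k1 : 0 < q < 1 -> 0 <= C -> x @ \oo --> xb ->
  (forall k, (k1 <= k)%N -> enorm (x k.+1 - x k) <= C * q ^+ k) ->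
  R_linear_cvg x xb.
Proof.
move=> /andP[q0 q1] C0 xxb step; split => //.
have q1' : 0 < 1 - q by rewrite subr_gt0.
have tail d k : (k1 <= k)%N -> enorm (x k - x (k + d)%N) <= C / (1 - q) * q ^+ k.
  elim: d k => [|d IH] k kk.
    rewrite addn0 subrr -(scale0r (0 : 'rV[R]_n)) enormZ normr0 mul0r.
    by rewrite mulr_ge0 ?divr_ge0 ?exprn_ge0 ?(ltW q0) ?(ltW q1').
  rewrite -addSnnS -[x k - _](subrKA (x k.+1)).
  apply: (le_trans (enorm_triangle _ _)).
  have := lerD (step k kk) (IH k.+1 (leqW kk)); rewrite enorm_distC => /le_trans; apply.
  by rewrite exprS le_eqVlt; apply/orP; left; apply/eqP; field; rewrite lt0r_neq0.
have dist k : (k1 <= k)%N -> enorm (x k - xb) <= C / (1 - q) * q ^+ k.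
  move=> kk; apply/ler_addgt0Pl => e e0.
  have /cvgr0Pnorm_lt/(_ e e0)[j _ /(_ (k + j)%N (leq_addl _ _))] :=
    cvg_enorm_dist x xb xxb.
  move=> /= H.
  rewrite -[x k - xb](subrKA (x (k + j)%N)); apply: (le_trans (enorm_triangle _ _)).
  rewrite addrC; apply: lerD; last exact: tail.
  by apply: ltW; apply: le_lt_trans H; exact: ler_norm.
have [r qr r1] : exists2 r, q < r & r < 1 by exists ((1 + q) / 2); lra.
have r0 : 0 < r by apply: lt_trans qr.
have [k2 _ small] : \forall k \near \oo, C / (1 - q) * q ^+ k <= r ^+ k.
  have qr1 : `|q / r| < 1.
    by rewrite gtr0_norm ?ltr_pdivrMr ?mul1r// divr_gt0.
  have /cvgr0Pnorm_lt/(_ 1 ltr01) := cvg_geometric (C / (1 - q)) qr1.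
  apply: filterS => k /= /(le_lt_trans (ler_norm _)) /ltW.
  by rewrite expr_div_n mulrA ler_pdivrMr ?exprn_gt0// mul1r.
apply: (@le_lt_trans _ _ r%:E); last by rewrite lte_fin.
apply: (@le_trans _ _ (ereal_sup ((fun k => (enorm (x k - xb) `^ (k%:R^-1))%:E) @`
   [set k | (maxn 1 (maxn k1 k2) <= k)%N]))).
  rewrite /limn_esup limf_esupE; apply: ereal_inf_lbound.
  by exists [set k | (maxn 1 (maxn k1 k2) <= k)%N] => //; exists (maxn 1 (maxn k1 k2)).
apply: ge_ereal_sup => _ [k /= + <-]; rewrite !geq_max => /and3P[k0 kk1 kk2].
rewrite lee_fin; have kn0 : (k%:R : R) != 0 by rewrite pnatr_eq0 -lt0n.
have -> : r = (r ^+ k) `^ (k%:R^-1).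
  by rewrite -powR_mulrn ?ltW// -powRrM mulfV// powRr1// ltW.
apply: ge0_ler_powR; rewrite ?nnegrE ?invr_ge0 ?exprn_ge0 ?enorm_ge0//.
  exact: ltW.
by apply: le_trans (dist k kk1) (small k kk2).
Qed.
End GeometricSequences.

(** * Bregman distances *)
Section Bregman.
Context {R : realType} {n : nat}.
Implicit Types (x y : 'rV[R]_n) (K : 'rV[R]_n -> R).

Lemma segment_closedT : segment_closed [set: 'rV[R]_n].
Proof. by []. Qed.

Lemma segment_closed_edom (psi : 'rV[R]_n -> \bar R) :
  convex_edom psi -> segment_closed (edom psi).
Proof.
move=> cvx x y t xd yd /andP[t0 t1].
have := cvx y x (Itv01 t0 t1); rewrite !inE => /(_ yd xd).
have -> : x + t *: (y - x) = t *: y + (1 - t) *: x.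
  by rewrite scalerBr scalerBl scale1r addrCA.
exact.
Qed.

Lemma bregman_le K (M : R) x y :
  (forall z, differentiable K z) -> lipschitz_with M setT (gradient K) ->
  bregman K x y <= M / 2 * enorm (y - x) ^+ 2.
Proof.
move=> dK lipK; rewrite /bregman opprD addrA.
apply: (@quadratic_upper_bound _ _ setT) => //.
exact: differentiable_expansion.
Qed.

(** Strong convexity at [x + t (y - x)], combined with the quadratic bound at [x],
    gives the claim up to an error of order [t]. *)
Lemma bregman_ge K (m M : R) x y :
  (forall z, differentiable K z) -> lipschitz_with M setT (gradient K) ->
  strongly_convex m K -> m / 2 * enorm (y - x) ^+ 2 <= bregman K x y.
Proof.
move=> dK lipK scK; rewrite /bregman.
set d := enorm (y - x) ^+ 2; set s := dot _ _.
have d0 : 0 <= d by rewrite sqr_ge0.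
have key t : 0 < t <= 1 ->
    s <= K y - K x - m / 2 * d + t * (m / 2 * d + `|M| / 2 * d).
  move=> /andP[t0 t1].
  have t01 : 0 <= t <= 1 by rewrite (ltW t0).
  have := scK y x t t01.
  have := quadratic_bound setT K (gradient K) M x (x + t *: (y - x))
    segment_closedT (differentiable_expansion K dK) lipK I I.
  rewrite ler_norml => /andP[+ _].
  have -> : t *: y + (1 - t) *: x = x + t *: (y - x).
    by rewrite scalerBr scalerBl scale1r addrCA.
  rewrite addrAC subrr add0r dotZr enormZ exprMn (ger0_norm (ltW t0)) -/s -/d => lo up.
  have MM := ler_norm M.
  have td : 0 <= t ^+ 2 * d by rewrite mulr_ge0// sqr_ge0.
  have MMtd := ler_wpM2r td MM.
  rewrite -(ler_pM2l t0); rewrite -/d in up; nra.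
rewrite leNgt; apply/negP => neg.
(* If the claim fails by [dl > 0], then [dl <= t * E] for all [t] in ]0, 1];
   the choice [t = dl / (dl + E + 1)] contradicts this. *)
set E := m / 2 * d + `|M| / 2 * d in key.
pose dl := s - (K y - K x - m / 2 * d).
have dl0 : 0 < dl by rewrite /dl; lra.
have E0 : 0 <= E.
  by have := key 1; rewrite ltr01 lexx => /(_ isT); rewrite /dl in dl0; lra.
have den : 0 < dl + E + 1 by lra.
have [t /andP[t0 t1] tE] : exists2 t, 0 < t <= 1 & t * (dl + E + 1) = dl.
  exists (dl / (dl + E + 1)); last by rewrite divfK// gt_eqF.
  by rewrite divr_gt0//= ler_pdivrMr// mul1r; lra.
have dlE : dl <= t * E by have := key t; rewrite t0 t1 => /(_ isT); rewrite /dl; lra.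
have := mulr_gt0 t0 dl0; lra.
Qed.
End Bregman.

(** * Lower semicontinuity *)
Section LowerSemicontinuity.
Context {R : realType} {T : topologicalType}.
Implicit Types psi f g : T -> \bar R.

Lemma lower_semicontinuousD f g :
  (forall x, (-oo < f x)%E) -> (forall x, (-oo < g x)%E) ->
  lower_semicontinuous f -> lower_semicontinuous g ->
  lower_semicontinuous (fun x => f x + g x)%E.
Proof.
move=> fNy gNy flsc glsc x a afg.
have [b bg af] : exists2 b : R, (b%:E < g x)%E & ((a - b)%:E < f x)%E.
  move: afg (fNy x) (gNy x); case: (f x) => [r||]; case: (g x) => [s||]//=.
  - rewrite -EFinD lte_fin => ars _ _; exists (s - (r + s - a) / 2);
    rewrite lte_fin; lra.
  - by move=> _ _ _; exists (a - r + 1); rewrite ?ltry// lte_fin; lra.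
  - by move=> _ _ _; exists (s - 1); rewrite ?ltry// lte_fin; lra.
  - by move=> _ _ _; exists 0; rewrite ltry.
have [V Vx VP] := flsc x _ af; have [W Wx WP] := glsc x _ bg.
exists (V `&` W); first exact: filterI.
move=> y [/VP fy /WP gy]; rewrite -(subrK b a) EFinD; exact: lteD.
Qed.

Lemma lower_semicontinuous_le psi (x : nat -> T) (xb : T) (c : \bar R) :
  lower_semicontinuous psi -> x @ \oo --> xb ->
  (\forall k \near \oo, (psi (x k) <= c)%E) -> (psi xb <= c)%E.
Proof.
move=> lsc xxb xc; rewrite leNgt; apply/negP => cpsi.
have [r cr rpsi] : exists2 r : R, (c <= r%:E)%E & (r%:E < psi xb)%E.
  move: cpsi; case: c {xc} => [r||].
  - by exists r.
  - by rewrite ltNge leey.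
  - case: (psi xb) => [r _||].
    + by exists (r - 1); rewrite ?leNye// lte_fin; lra.
    + by exists 0; rewrite ?leNye ?ltry.
    + by rewrite ltxx.
have [V Vx VP] := lsc _ _ rpsi.
have [k [xkc /VP]] : exists k, (psi (x k) <= c)%E /\ V (x k).
  have [k [] ] := @filter_ex _ _ _ _ (filterI xc (xxb _ Vx)); by exists k.
by rewrite ltNge (le_trans xkc cr).
Qed.
End LowerSemicontinuity.

(** * The proximal step *)
Section ProxStep.
Context {R : realType} {n : nat}.
Implicit Types (x y p u : 'rV[R]_n) (f g : 'rV[R]_n -> \bar R).

(** The objective is finite at the points of the domain of [g], hence at its
    minimisers. *)
Lemma prox_map_edom f df g (K : 'rV[R]_n -> R) (eps : R) x p :
  eproper g -> prox_map f df g K eps x p -> edom g p.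
Proof.
move=> [gNy [y yg]] [_ /(_ y)]; rewrite /prox_objective /edom /=.
move: yg (gNy y) (gNy p); rewrite /edom/=.
by case: (g y) => [r||]//; case: (g p) => [s||]// => _ _ _; rewrite ltry.
Qed.

(** Compare the proximal objective at [p] and at [u]: the linear terms in [df x] are
    replaced by [f p - f x] and [f u - f x], each at the cost of [L / 2] times a
    squared distance, and the Bregman distance is bounded below at [p] by strong
    convexity and above at [u] by the Lipschitz gradient. *)
Lemma prox_step f g df (L : R) (K : 'rV[R]_n -> R) (m M eps : R) x p :
  eproper f -> convex_edom f ->
  (forall z, edom f z -> is_gradient_on_dom f z (df z)) ->
  lipschitz_with L (edom f) df ->
  eproper g ->
  (forall z, differentiable K z) -> lipschitz_with M setT (gradient K) ->
  strongly_convex m K -> 0 < eps ->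
  prox_map f df g K eps x p -> edom f p -> forall u,
  (f p + g p + ((m / eps - L) / 2 * enorm (p - x) ^+ 2)%:E <=
   f u + g u + ((M / eps + L) / 2 * enorm (u - x) ^+ 2)%:E)%E.
Proof.
move=> f_proper f_cvx f_diff df_lip g_proper dK lipK scK eps0 T pf u.
have pg := prox_map_edom _ _ _ _ _ _ _ g_proper T.
have [xf /(_ u)] := T.
have [uf|] := boolP (f u < +oo)%E; last first.
  rewrite -leNgt leye_eq => /eqP fu _; rewrite fu addye ?addye ?leey//.
  by have := g_proper.1 u; case: (g u).
have bound v : edom f v ->
  `|fine (f v) - fine (f x) - dot (df x) (v - x)| <= L / 2 * enorm (v - x) ^+ 2.
  move=> fv; apply: (@quadratic_bound _ _ (edom f) (fine \o f)) => //.
  exact: segment_closed_edom.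
move: (bound p pf) (bound u uf) => {bound}.
rewrite /prox_objective.
have Bp := bregman_ge K m M x p dK lipK scK.
have Bu := bregman_le K M x u dK lipK.
move: pf pg uf (f_proper.1 p) (f_proper.1 u) (g_proper.1 p) (g_proper.1 u).
rewrite /edom /=.
case: (f p) => [fp||]//; case: (g p) => [gp||]// _ _; case: (f u) => [fu||]// _ _ _ _.
case: (g u) => [gu||]// _; last by move=> *; exact: leey.
rewrite !ler_norml /= -!EFinD !lee_fin => /andP[_ Hp] /andP[Hu _] H.
have e0 : 0 < eps^-1 by rewrite invr_gt0.
have {}Bp := ler_wpM2l (ltW e0) Bp; have {}Bu := ler_wpM2l (ltW e0) Bu.
rewrite -(mulrC eps^-1) -(mulrC eps^-1 M); lra.
Qed.
End ProxStep.

(** * Linear convergence *)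

(** Quadratic growth passes from the points of [C] to the distance to [C], which
    need not be attained: if [b] exceeded the bound, then [C] would contain a
    point closer to [z] than the square root of [(b - c) / c0]. *)
Lemma edist_to_growth {R : realType} {n : nat} (z : 'rV[R]_n) (C : set 'rV[R]_n)
    (b : \bar R) (r c c0 : R) : 0 <= r -> 0 < c0 ->
  (edist_to z C <= r%:E)%E ->
  (forall u, C u -> (b <= (c + c0 * enorm (u - z) ^+ 2)%:E)%E) ->
  (b <= (c + c0 * r ^+ 2)%:E)%E.
Proof.
move=> r0 c00 zC bC.
have near_pt s : r < s -> exists2 u, C u & enorm (u - z) < s.
  move=> rs; have /ereal_inf_lt[_ [u Cu <-]] : (edist_to z C < s%:E)%E.
    by apply: le_lt_trans zC _; rewrite lte_fin.
  by rewrite lte_fin enorm_distC => us; exists u.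
case: b bC => [b||] bC; last by rewrite leNye.
  rewrite lee_fin leNgt; apply/negP => bgt.
  have q0 : r ^+ 2 < (b - c) / c0 by rewrite ltr_pdivlMr// mulrC; lra.
  have qge : 0 <= (b - c) / c0 by apply: le_trans (ltW q0); exact: sqr_ge0.
  have [|u Cu uz] := near_pt (Num.sqrt ((b - c) / c0)).
    by rewrite -(ger0_norm r0) -sqrtr_sqr ltr_sqrt// (le_lt_trans _ q0)// sqr_ge0.
  have : enorm (u - z) ^+ 2 < (b - c) / c0.
    by rewrite -[ltRHS](sqr_sqrtr qge) ltrXn2r// ?nnegrE ?enorm_ge0 ?sqrtr_ge0.
  rewrite ltr_pdivlMr// mulrC => lt.
  by have := bC u Cu; rewrite lee_fin; lra.
have [|u /bC] := near_pt (r + 1); first by lra.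
by rewrite leye_eq.
Qed.

Lemma quadratic_bound_limit {R : realType} {n : nat} (x : nat -> 'rV[R]_n)
    (xb u : 'rV[R]_n) (b c c0 : R) : 0 <= c0 -> x @ \oo --> xb ->
  (forall k, b <= c + c0 * enorm (u - x k) ^+ 2) ->
  b <= c + c0 * enorm (u - xb) ^+ 2.
Proof.
move=> c00 xxb bk.
have lim : c + c0 * (enorm (u - xb) + enorm (x k - xb)) ^+ 2 @[k --> \oo] -->
           c + c0 * (enorm (u - xb) + 0) ^+ 2.
  apply: cvgD; first exact: cvg_cst.
  apply: cvgMr; rewrite expr2; under eq_fun do rewrite expr2.
  by apply: cvgM; (apply: cvgD; [exact: cvg_cst | exact: cvg_enorm_dist]).
rewrite addr0 in lim; apply: (cvgr_to_ge lim); apply: nearW => k.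
apply: (le_trans (bk k)); rewrite lerD2l ler_wpM2l//.
rewrite lerXn2r ?nnegrE ?addr_ge0 ?enorm_ge0//.
by rewrite (enorm_distC (x k)) -[u - x k](subrKA xb) enorm_triangle.
Qed.

Theorem theorem5p1 (R : realType) (n : nat)
  (f g F : 'rV[R]_n -> \bar R) (df : 'rV[R]_n -> 'rV[R]_n) (L : R)
  (L_gt0 : 0 < L)
  (f_proper : eproper f) (f_lsc : lower_semicontinuous f)
  (f_dom : convex_edom f)
  (f_diff : forall z, edom f z -> is_gradient_on_dom f z (df z))
  (df_lip : lipschitz_with L (edom f) df)
  (g_proper : eproper g) (g_lsc : lower_semicontinuous g)
  (g_cont : {within edom g, continuous g})
  (g_dom : convex_edom g)
  (F_def : forall z, F z = (f z + g z)%E)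
  (F_lb : level_bounded F)
  (K : nat -> 'rV[R]_n -> R) (mk Mk : nat -> R) (m M : R)
  (m_gt0 : 0 < m) (mk_ge : forall k, m <= mk k)
  (Mk_le : forall k, Mk k <= M)
  (K_sconv : forall k, strongly_convex (mk k) (K k))
  (K_diff : forall k z, differentiable (K k) z)
  (dK_lip : forall k, lipschitz_with (Mk k) setT (gradient (K k)))
  (eps : nat -> R) (epsl epsu : R)
  (epsl_gt0 : 0 < epsl) (eps_bd : forall k, epsl <= eps k <= epsu)
  (epsu_lt : epsu < m / L)
  (x : nat -> 'rV[R]_n) (x_vbpg : vbpg f df g K eps x)
  (xb : 'rV[R]_n) (x_cvg : x @ \oo --> xb)
  (xb_crit : limiting_critical f df g xb)
  (gamma eta nu : R) (gamma_bd : 0 < gamma <= 1)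
  (eta_gt0 : 0 < eta) (nu_gt0 : 0 < nu)
  (F_eb : level_set_error_bound F xb gamma eta nu)
  (N : R) (N_gt : (2 * epsu * nu) / (m - epsu * L) / (eta / 2) ^+ 2 < N)
  (a : R) (a_def : a = 2^-1 * (m / epsu - L))
  (theta : R) (theta_gt0 : 0 < theta)
  (theta_bd : forall k z, ball_slice F xb (eta / 2) (nu / N) z ->
     (edist_to z (sublevel F (F xb))
        <= theta%:E * edist_to z (prox_map f df g (K k) (eps k) z))%E)
  (c0 : R) (c0_def : c0 = 3 / 2 * L + M / (2 * epsl))
  (kappa : R) (kappa_def : kappa = c0 * theta ^+ 2)
  (sigma : R) (sigma_bd : 0 < sigma < eta / 2)
  (nub : R)
  (nub_bd : 0 < nub < Num.min (nu / N) (a * (eta / 2 - sigma) ^+ 2))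
  (k0 : nat) (Fk0_bd : (F xb < F (x k0) < F xb + nub%:E)%E)
  (xk0_bd : enorm (x k0 - xb)
     + 2 * (Num.sqrt a + Num.sqrt kappa) / a
       * Num.sqrt (fine (F (x k0) - F xb)%E) < sigma) :
  [/\ Q_linear_cvg (F \o x) (F xb),
      exists S : R,
        (\sum_(1 <= i < j) (F (x i) - F xb))%E @[j --> \oo] --> S%:E &
      exists xh : 'rV[R]_n,
        [/\ R_linear_cvg x xh,
            limiting_critical f df g xh &
            forall (D : 'rV[R]_n -> 'rV[R]_n -> R) (epsh : R),
              (forall k, bregman (K k) = D) ->
              eps @ \oo --> epsh -> epsl < epsh < m / L ->
              proximal_critical F xh]].
Proof.
have epsu_gt0 : 0 < epsu.
  by have /andP[h1 h2] := eps_bd 0%N; apply: lt_le_trans (le_trans h1 h2).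
have eps_gt0 k : 0 < eps k.
  by have /andP[h1 _] := eps_bd k; exact: lt_le_trans h1.
have a_gt0 : 0 < a.
  by rewrite a_def mulr_gt0// subr_gt0 ltr_pdivlMr// mulrC -ltr_pdivlMr.
have FNy z : (-oo < F z)%E.
  rewrite F_def; move: (f_proper.1 z) (g_proper.1 z).
  by case: (f z) => [r||]//; case: (g z) => [s||]//= _ _; rewrite ltNyr.
have F_lsc : lower_semicontinuous F.
  rewrite (_ : F = fun z => (f z + g z)%E); last exact/funext.
  exact: (lower_semicontinuousD _ _ f_proper.1 g_proper.1).
have xf k : edom f (x k) by case: (x_vbpg k).
have xg k : edom g (x k.+1) by exact: (prox_map_edom _ _ _ _ _ _ _ g_proper (x_vbpg k)).
have fin_dom z : edom f z -> edom g z -> F z \is a fin_num.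
  move=> zf zg; rewrite F_def fin_numD.
  by rewrite !fin_real// (f_proper.1, g_proper.1).
have xb_f : edom f xb by case: xb_crit.
have Fxb_fin : F xb \is a fin_num.
  by apply: fin_dom => //; case: xb_crit => _ [xi []].
have Fx_fin k : (0 < k)%N -> F (x k) \is a fin_num.
  by case: k => // k _; exact: fin_dom.
(* The gradient of [K 0] can only be Lipschitz with a negative constant on a
   one-point space, and the starting slice contains a point other than [xb]. *)
have M_ge0 : 0 <= M.
  have xk0_pos : 0 < enorm (x k0 - xb).
    rewrite lt_neqAle enorm_ge0 andbT eq_sym; apply/eqP => e0.
    have : `|x k0 - xb| <= 0 by rewrite -e0 sup_le_enorm.
    rewrite normr_le0 subr_eq0 => /eqP xk0E.
    by move: Fk0_bd; rewrite xk0E ltxx.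
  apply: le_trans (Mk_le 0%N); rewrite -(pmulr_lge0 _ xk0_pos).
  apply: le_trans (dK_lip 0%N (x k0) xb I I); exact: enorm_ge0.
have c0_gt0 : 0 < c0.
  rewrite c0_def ltr_pwDl ?divr_ge0 ?mulr_ge0 ?(ltW epsl_gt0)//.
  by rewrite mulr_gt0.
have step k u : (F (x k.+1) + (a * enorm (x k.+1 - x k) ^+ 2)%:E <=
    F u + (c0 * enorm (u - x k) ^+ 2)%:E)%E.
  have := prox_step f g df L (K k) (mk k) (Mk k) (eps k) (x k) (x k.+1)
    f_proper f_dom f_diff df_lip g_proper (K_diff k) (dK_lip k) (K_sconv k)
    (eps_gt0 k) (x_vbpg k) (xf k.+1) u.
  rewrite -!F_def => H; have /andP[el eu] := eps_bd k.
  have e0 : 0 < (eps k)^-1 by rewrite invr_gt0.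
  have me : m / epsu <= mk k / eps k.
    apply: (@le_trans _ _ (m / eps k)); last by rewrite ler_pM2r.
    by rewrite ler_pM2l// lef_pV2 ?posrE.
  have Me : Mk k / eps k <= M / epsl.
    apply: (@le_trans _ _ (M / eps k)); first by rewrite ler_pM2r.
    by rewrite ler_wpM2l// lef_pV2 ?posrE.
  apply: (@le_trans _ _ (F (x k.+1) +
      ((mk k / eps k - L) / 2 * enorm (x k.+1 - x k) ^+ 2)%:E)%E).
    rewrite leeD2lE ?Fx_fin// lee_fin ler_wpM2r ?sqr_ge0// a_def; lra.
  apply: (le_trans H); apply: leeD => //.
  rewrite lee_fin ler_wpM2r ?sqr_ge0// c0_def.
  have -> : M / (2 * epsl) = M / epsl / 2 by rewrite invfM mulrA mulrAC.
  lra.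
have decr k : (F (x k.+1) + (a * enorm (x k.+1 - x k) ^+ 2)%:E <= F (x k))%E.
  have := step k (x k).
  by rewrite subrr -(scale0r (0 : 'rV[R]_n)) enormZ normr0 mul0r expr0n mulr0 adde0.
have F_le k : (F (x k.+1) <= F (x k))%E.
  apply: le_trans (decr k); apply: leeDl; rewrite lee_fin mulr_ge0 ?sqr_ge0//.
  exact: ltW.
have F_mono : {homo (fun k => F (x k)) : i j / (i <= j)%N >-> (j <= i)%E}.
  by apply/nonincreasing_seqP.
have Fxb_le k : (F xb <= F (x k))%E.
  apply: (lower_semicontinuous_le F x xb) => //.
  by exists k => // j /= kj; exact: F_mono.
pose Fb := fine (F xb); pose phi k := fine (F (x k)) - Fb.
have FbE : F xb = Fb%:E by rewrite fineK.
have phiE k : (0 < k)%N -> F (x k) = (Fb + phi k)%:E.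
  by move=> k_gt0; rewrite /phi addrC subrK fineK// Fx_fin.
have phi_ge0 k : (0 < k)%N -> 0 <= phi k.
  by move=> k_gt0; have := Fxb_le k; rewrite phiE// FbE lee_fin lerDl.
have phi_decr k : (0 < k)%N -> phi k.+1 + a * enorm (x k.+1 - x k) ^+ 2 <= phi k.
  by move=> k_gt0; have := decr k; rewrite !phiE// -EFinD lee_fin -addrA lerD2l.
have kappa_gt0 : 0 < kappa by rewrite kappa_def mulr_gt0// exprn_gt0.
(* [k1] is positive because [F (x 0)] may be infinite, while all later values
   are finite. *)
have [k1 k1_gt0 phi_step] : exists2 k1, (0 < k1)%N &
    forall k, (k1 <= k)%N -> phi k.+1 <= kappa * enorm (x k.+1 - x k) ^+ 2.
  have /cvgr0Pnorm_lt/(_ (eta / 2)) := cvg_enorm_dist x xb x_cvg.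
  move=> /(_ (ltac:(by rewrite divr_gt0)))[j _ xj].
  exists (maxn 1 (maxn j k0)); first by rewrite leq_max.
  move=> k; rewrite !geq_max => /and3P[k_gt0 jk k0k].
  have s_ge0 := enorm_ge0 (x k.+1 - x k).
  have [Fk|Fk] := eqVneq (F (x k)) (F xb).
    have := F_le k; rewrite Fk FbE phiE// lee_fin gerDl => /le_trans; apply.
    by rewrite mulr_ge0 ?sqr_ge0// ltW.
  have slice : ball_slice F xb (eta / 2) (nu / N) (x k).
    split; first by rewrite /eball/=; apply: le_lt_trans (xj k jk); exact: ler_norm.
    rewrite /= lt_neqAle eq_sym Fk Fxb_le/=.
    have /andP[_ Fk0] := Fk0_bd.
    apply: le_lt_trans (F_mono _ _ k0k) (lt_le_trans Fk0 _).
    apply: leeD => //; rewrite lee_fin.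
    by move: nub_bd => /andP[_]; rewrite lt_min => /andP[/ltW].
  have : (edist_to (x k) (sublevel F (F xb)) <=
      (theta * enorm (x k.+1 - x k))%:E)%E.
    apply: (le_trans (theta_bd k (x k) slice)).
    rewrite EFinM lee_pmul2l ?lte_fin// enorm_distC.
    by apply: ereal_inf_lbound; exists (x k.+1).
  move=> /(edist_to_growth _ _ (F (x k.+1)) _ Fb c0).
  rewrite phiE// kappa_def => /(_ _ _ _).
  rewrite lee_fin lerD2l exprMn mulrA; apply => //.
    by rewrite mulr_ge0// ltW.
  move=> u Fu; rewrite -phiE//.
  apply: (@le_trans _ _ (F u + (c0 * enorm (u - x k) ^+ 2)%:E)%E); last first.
    by rewrite EFinD; apply: leeD => //; rewrite -FbE.
  apply: le_trans (step k u); apply: leeDl; rewrite lee_fin mulr_ge0 ?sqr_ge0//.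
  exact: ltW.
(* [phi_step] and [phi_decr] bound [(a + kappa) * phi k.+1] by [kappa * phi k]. *)
have [b /andP[b_gt0 b_lt1] ratio] : exists2 b : R, 0 < b < 1 &
    forall k, (k1 <= k)%N -> phi k.+1 <= b * phi k.
  have den : 0 < a + kappa by rewrite addr_gt0.
  exists (kappa / (a + kappa)).
    by rewrite divr_gt0//= ltr_pdivrMr// mul1r ltrDr.
  move=> k kk; have k_gt0 : (0 < k)%N by exact: leq_trans kk.
  move: (phi_step k kk) (phi_decr k k_gt0).
  move: (phi k) (phi k.+1) (enorm _ ^+ 2) => u v s h1 h2.
  rewrite mulrAC ler_pdivlMr//.
  have := ler_wpM2l (ltW kappa_gt0) h2; have := ler_wpM2l (ltW a_gt0) h1.
  move: h1 h2; lra.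
have [C C_ge0 decay] : exists2 C : R, 0 <= C &
    forall k, (k1 <= k)%N -> phi k <= C * b ^+ k.
  exists (phi k1 / b ^+ k1) => [|k kk].
    by rewrite divr_ge0 ?phi_ge0// exprn_ge0// ltW.
  apply: le_trans (geometric_decay phi b k1 (ltW b_gt0) ratio k kk) _.
  have -> : b ^+ k = b ^+ (k - k1) * b ^+ k1 by rewrite -exprD subnK.
  by rewrite mulrCA divfK// expf_neq0// gt_eqF.
have phi_cvg : phi @ \oo --> (0 : R).
  have b1 : `|b| < 1 by rewrite gtr0_norm.
  apply: (@squeeze_cvgr _ _ _ _ (cst 0) (geometric C b)).
  - exists k1 => // k /= kk; rewrite decay// phi_ge0//; exact: leq_trans kk.
  - exact: cvg_cst.
  - exact: cvg_geometric.
split.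
- split.
    rewrite FbE; apply/fine_cvgP; split; first by exists 1%N => // k; exact: Fx_fin.
    rewrite -[X in _ --> X]add0r.
    rewrite (_ : _ \o _ = phi + cst Fb); last first.
      by apply/funext => k; rewrite /phi !fctE subrK.
    by apply: cvgD => //; exact: cvg_cst.
  exists b; first by rewrite b_gt0.
  exists k1 => k kk; have k_gt0 : (0 < k)%N by exact: leq_trans kk.
  rewrite /= FbE !phiE// -!EFinB -EFinM lee_fin !(addrC Fb) !addrK; exact: ratio.
- have [S PS] := ratio_summable phi b 1 k1 b_lt1 phi_ge0 ratio.
  exists S; rewrite (_ : (fun j => _) = fun j => (\sum_(1 <= i < j) phi i)%:E).
    by apply/fine_cvgP; split; [exact: nearW | exact: PS].
  apply/funext => j; rewrite -sumEFin; apply: eq_big_nat => i /andP[i_gt0 _].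
  by rewrite phiE// FbE -EFinB addrC addKr.
- exists xb; split => //.
    apply: (geometric_steps_R_linear x xb (Num.sqrt b) (Num.sqrt (C / a)) k1).
    + by rewrite sqrtr_gt0 b_gt0 -sqrtr1 ltr_sqrt.
    + exact: sqrtr_ge0.
    + exact: x_cvg.
    + move=> k kk; have k_gt0 : (0 < k)%N by exact: leq_trans kk.
      rewrite -(@ler_pXn2r _ 2) ?nnegrE ?mulr_ge0 ?exprn_ge0 ?sqrtr_ge0 ?enorm_ge0//.
      rewrite exprMn exprAC !sqr_sqrtr ?divr_ge0 ?dot_self_ge0
         ?(ltW a_gt0) ?(ltW b_gt0)//.
      rewrite mulrAC ler_pdivlMr// mulrC; apply: le_trans (decay k kk).
      by rewrite -sqr_enorm; apply: le_trans (phi_decr k k_gt0); rewrite lerDr phi_ge0.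
  move=> _ _ _ _ _; split; first by rewrite /edom/= FbE ltry.
  exists c0, 1; split => // y _.
  rewrite -(scale0r (0 : 'rV[R]_n)) dotC dotZr mul0r sub0r.
  case Fy : (F y) => [r||]; [|by rewrite leey|by have := FNy y; rewrite Fy].
  rewrite FbE -EFinD lee_fin lerBlDr.
  apply: (quadratic_bound_limit x xb y Fb r c0 (ltW c0_gt0) x_cvg) => k.
  rewrite -lee_fin EFinD -Fy -FbE; apply: le_trans (Fxb_le k.+1) _.
  apply: le_trans (step k y); apply: leeDl; rewrite lee_fin mulr_ge0 ?sqr_ge0//.
  exact: ltW.
Qed.
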